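(* For each integer $\Delta>0$ and each even integer $d>0$ there exist a non-negative matrix $A\in\mathbb{Z}_{\ge 0}^{d\times d}$ with $\lVert A\rVert_\infty=\Delta$, a right-hand side $b\in\mathbb{Z}_{\ge 0}^d$ and a right-hand side $b'\in\mathbb{Z}_{\ge 0}^d$ with $\lVert b-b'\rVert_1=1$ such that $\mathrm{sens}(A,b,b')\ge \Delta^{\Theta(d)}$. Furthermore, the underlying ILP is polytopish.
   Context: For $x\in\mathbb{R}^n$ and $Y\subseteq\mathbb{R}^n$ let $\mathrm{dist}(x,Y)=\min_{y\in Y}\lVert x-y\rVert_\infty$, and for $X,Y\subseteq\mathbb{R}^n$ let $\mathrm{dist}(X,Y)=\max_{x\in X}\mathrm{dist}(x,Y)$. For $A\in\mathbb{Z}^{d\times n}$ of full row rank, $b\in\mathbb{Z}^d$ and objective $c\in\mathbb{Z}^n$, let $\mathrm{IntSol}(A,b,c)$ be the set of optimal solutions of $\min\{c^\top x: Ax=b,\ x\in\mathbb{Z}^n_{\ge 0}\}$. The sensitivity is $\mathrm{sens}(A,b,b',c)=\mathrm{dist}(\mathrm{IntSol}(A,b,c),\mathrm{IntSol}(A,b',c))$, and $\mathrm{sens}(A,b,b')$ denotes this quantity with the zero objective $c=0$ (so $\mathrm{IntSol}$ is the set of all non-negative integral solutions). $\Delta$ denotes $\lVert A\rVert_\infty$, the largest absolute value of an entry of $A$. ''$\ge\Delta^{\Theta(d)}$'' means at least $\Delta^{\gamma d}$ for an absolute constant $\gamma>0$ independent of $\Delta$ and $d$. An ILP $\min\{c^\top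 x: Ax=b, x\in\mathbb{Z}^n_{\ge0}\}$ is called polytopish if there is a polytope $\mathcal{P}\subseteq\mathbb{R}^d$ such that the columns of $A$ are exactly the integer points of $\mathcal{P}$ (each appearing once), i.e. the ILP has the form $\min\{c^\top x:\sum_{p\in\mathcal{P}\cap\mathbb{Z}^d}x_p p=b,\ x\ge 0 \text{ integral}\}$. *)

(* Defs.v *)
From HB Require Import structures.
From mathcomp Require Import all_boot all_order all_algebra.
From mathcomp Require Import all_classical all_reals all_analysis.
Set Implicit Arguments.
Unset Strict Implicit.
Unset Printing Implicit Defensive.
Import Order.TTheory GRing.Theory Num.Theory.
Local Open Scope classical_set_scope.
Local Open Scope ring_scope.

Definition intmx (R : realType) (m n : nat) (A : 'M[int]_(m, n)) : 'M[R]_(m, n) :=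
  map_mx intr A.

(* [mx_norm] is the maximum of the absolute values of the entries, so on column
   vectors it is the infinity norm.  Min and max are rendered by inf and sup in
   the extended reals; the inf is attained when [Y] is a nonempty set of
   integer vectors.  Conventions: dist(x, set0) = +oo and dist(set0, Y) = -oo. *)
Definition pt_dist (R : realType) (n : nat) (x : 'cV[R]_n) (Y : set 'cV[R]_n)
    : \bar R :=
  ereal_inf [set (mx_norm (x - y))%:E | y in Y].

Definition set_dist (R : realType) (n : nat) (X Y : set 'cV[R]_n) : \bar R :=
  ereal_sup [set pt_dist x Y | x in X].

Definition IntFeas (d n : nat) (A : 'M[int]_(d, n)) (b : 'cV[int]_d)
    : set 'cV[int]_n :=
  [set x | A *m x = b /\ forall j, 0 <= x j 0].

Definition objective (n : nat) (c x : 'cV[int]_n) : int := (c^T *m x) 0 0.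

Definition IntSol (d n : nat) (A : 'M[int]_(d, n)) (b : 'cV[int]_d)
    (c : 'cV[int]_n) : set 'cV[int]_n :=
  [set x | IntFeas A b x /\
           forall y, IntFeas A b y -> objective c x <= objective c y].

Definition sens (R : realType) (d n : nat) (A : 'M[int]_(d, n))
    (b b' : 'cV[int]_d) (c : 'cV[int]_n) : \bar R :=
  set_dist (@intmx R n 1 @` IntSol A b c) (@intmx R n 1 @` IntSol A b' c).

Definition norm1 (d : nat) (v : 'cV[int]_d) : int := \sum_i `|v i 0|.

Definition full_row_rank (d n : nat) (A : 'M[int]_(d, n)) : bool :=
  row_free (map_mx intr A : 'M[rat]_(d, n)).

Definition conv_hull (R : realType) (d m : nat) (v : 'I_m -> 'cV[R]_d)
    : set 'cV[R]_d :=
  [set x | exists w : 'I_m -> R,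
     [/\ forall i, 0 <= w i, \sum_i w i = 1 & x = \sum_i w i *: v i]].

Definition polytope (R : realType) (d : nat) (P : set 'cV[R]_d) : Prop :=
  exists (m : nat) (v : 'I_m -> 'cV[R]_d), P = conv_hull v.

(* The property depends only on the constraint matrix of the ILP; injectivity
   says that every integer point of the polytope occurs as a column once. *)
Definition polytopish (R : realType) (d n : nat) (A : 'M[int]_(d, n)) : Prop :=
  exists P : set 'cV[R]_d,
    [/\ polytope P,
        injective (fun j : 'I_n => col j A) &
        forall p : 'cV[int]_d, P (intmx R p) <-> exists j : 'I_n, col j A = p].

(* Main.v *)
Require Import Defs.
From HB Require Import structures.
From mathcomp Require Import all_boot all_order all_algebra.
From mathcomp Require Import all_classical all_reals all_analysis.
From mathcomp Require Import zify.
Set Implicit Arguments.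
Unset Strict Implicit.
Unset Printing Implicit Defensive.
Import Order.TTheory GRing.Theory Num.Theory.
Local Open Scope classical_set_scope.
Local Open Scope ring_scope.

(** If A is unimodular then, for a nonnegative integral x, the only solution of
    the system with right-hand side A x is x itself, and an integer point of the
    convex hull of the columns of A has integral barycentric coordinates, so it
    is a column.  Hence it suffices to find a nonnegative unimodular A with
    entries at most Delta whose inverse has a large entry: the bidiagonal matrix
    with 1 on the diagonal and Delta below it sends z := ((-Delta)^i)_i to the
    first unit vector, and b, b' are the images of the positive and negative
    parts of z.  This yields sensitivity Delta^(d-1), and d - 1 >= d/2. *)

Lemma le_mx_norm (K : realDomainType) (m n : nat) (M : 'M[K]_(m, n)) i j :
  `|M i j| <= mx_norm M.
Proof.
by rewrite mx_normrE (le_bigmax _ (fun ij => `|M ij.1 ij.2|) (i, j)).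
Qed.

Lemma unitmx_full_row_rank (n : nat) (A : 'M[int]_n) :
  A \in unitmx -> full_row_rank A.
Proof.
move=> Au; rewrite /full_row_rank row_free_unit unitmxE det_map_mx.
by rewrite (rmorph_unit (intr : {rmorphism int -> rat})) -?unitmxE.
Qed.

Lemma IntSol_unitmx (n : nat) (A : 'M[int]_n) (x : 'cV[int]_n) :
  A \in unitmx -> (forall j, 0 <= x j 0) -> IntSol A (A *m x) 0 = [set x].
Proof.
move=> Au x0; apply/seteqP; split => [y [[Ay _] _]|_ ->] /=.
  by rewrite -(mulKmx Au y) Ay mulKmx.
by split=> // y _; rewrite /objective trmx0 !mul0mx.
Qed.

(** Both solution sets are singletons, so the supremum and the infimum collapse to one distance. *)
Lemma sens_unitmx (R : realType) (n : nat) (A : 'M[int]_n) (x y : 'cV[int]_n) :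
  A \in unitmx -> (forall j, 0 <= x j 0) -> (forall j, 0 <= y j 0) ->
  sens R A (A *m x) (A *m y) 0 = (mx_norm (intmx R (x - y)))%:E.
Proof.
move=> Au x0 y0; rewrite /sens !IntSol_unitmx// !image_set1 /set_dist image_set1.
by rewrite ereal_sup1 /pt_dist image_set1 ereal_inf1 /intmx map_mxB.
Qed.

(** By integrality a nonzero entry is at least 1, so it exhausts the sum and the others vanish. *)
Lemma nonneg_sum1_delta (n : nat) (q : 'cV[int]_n) :
  (forall i, 0 <= q i 0) -> \sum_i q i 0 = 1 -> exists j, q = delta_mx j 0.
Proof.
move=> q0 q1.
have [j qj] : exists j, q j 0 != 0.
  apply/existsP; apply: contraPT q1 => /existsPn qE.
  by rewrite big1// => i _; have /negPn/eqP := qE i.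
have S0 : 0 <= \sum_(i | i != j) q i 0 by apply: sumr_ge0.
move: q1; rewrite (bigD1 j)//= => q1.
have qj1 : q j 0 = 1.
  by apply/le_anti; rewrite -[leRHS]q1 lerDl S0 -gtz0_ge1 lt_def qj q0.
have Sj : \sum_(i | i != j) q i 0 = 0.
  by apply: (addrI 1); rewrite addr0 -[in LHS]qj1.
exists j; apply/colP => i; rewrite mxE eqxx andbT.
have [->//|ij] := eqVneq i j.
by rewrite (psumr_eq0P _ Sj).
Qed.

Lemma unitmx_polytopish (R : realType) (n : nat) (A : 'M[int]_n) :
  A \in unitmx -> polytopish R A.
Proof.
move=> Au; pose v (j : 'I_n) := intmx R (col j A).
exists (conv_hull v); split; first by exists n, v.
  move=> j k; rewrite !colE => /(can_inj (mulKmx Au))/matrixP/(_ j 0).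
  by rewrite !mxE !eqxx /= andbT; case: eqVneq.
move=> p; split=> [[w [w0 w1 pE]]|[j <-]]; last first.
  exists (fun i => (i == j)%:R); split=> [i||]; first exact: ler0n.
    by rewrite (bigD1 j)//= eqxx big1 ?addr0// => i /negPf ->.
  rewrite (bigD1 j)//= eqxx scale1r big1 ?addr0// => i /negPf ->.
  by rewrite scale0r.
(* Invertibility makes the barycentric coordinates unique: the real weights [w] must agree with the
   integral vector [q]. *)
pose q := invmx A *m p.
have qE i : (q i 0)%:~R = w i.
  suff : intmx R q = \col_i w i by move/colP/(_ i); rewrite !mxE.
  have -> : intmx R q = map_mx intr (invmx A) *m intmx R p by rewrite -map_mxM.
  have -> : intmx R p = map_mx intr A *m \col_i w i.
    rewrite pE; apply/colP => k; rewrite summxE mxE; apply: eq_bigr => l _.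
    by rewrite !mxE mulrC.
  by rewrite mulmxA -map_mxM mulVmx// map_mx1 mul1mx.
have [j qj] : exists j, q = delta_mx j 0.
  apply: nonneg_sum1_delta => [i|]; first by rewrite -(ler0z R) qE.
  apply: (@intr_inj R); rewrite rmorph_sum /= -[RHS]w1.
  by apply: eq_bigr => i _; rewrite qE.
by exists j; rewrite colE -qj mulKVmx.
Qed.

Definition bidiag (n : nat) (D : int) : 'M[int]_n :=
  \matrix_(i, j) ((i == j)%:R + D *+ (i == j.+1 :> nat)).

Definition alt_powers (n : nat) (D : int) : 'cV[int]_n := \col_i (- D) ^+ i.

Lemma bidiag_unitmx (n : nat) (D : int) : bidiag n D \in unitmx.
Proof.
rewrite unitmxE det_trig; last first.
  apply/is_trig_mxP => i j ij; rewrite mxE -val_eqE /= (ltn_eqF ij).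
  by rewrite (ltn_eqF (leqW ij)).
rewrite big1 ?unitr1// => i _.
by rewrite mxE eqxx ltn_eqF// addr0.
Qed.

Lemma bidiag_alt_powers (n : nat) (D : int) :
  bidiag n.+1 D *m alt_powers n.+1 D = delta_mx 0 0.
Proof.
apply/colP => i; rewrite mxE [RHS]mxE eqxx andbT.
under eq_bigr do rewrite !mxE mulrDl.
rewrite big_split /= (bigD1 i)//= eqxx mul1r big1 ?addr0; last first.
  by move=> j /negPf; rewrite eq_sym => ->; rewrite mul0r.
(* The diagonal has contributed [(- D) ^+ i]. Row 0 has no subdiagonal entry; in row [k.+1] that
   entry contributes [D * (- D) ^+ k], which cancels the diagonal term. *)
case: i => -[|k] kn /=.
  by rewrite big1 ?addr0// => j _; rewrite mulr0n mul0r.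
rewrite (bigD1 (Ordinal (ltnW kn)))//= eqxx mulr1n big1 ?addr0; last first.
  move=> j; rewrite -val_eqE /= => /negPf kj.
  by rewrite eqSS eq_sym kj mulr0n mul0r.
by rewrite exprS mulNr addNr.
Qed.

Lemma bidiag_ge0 (n : nat) (D : int) i j : 0 <= D -> 0 <= bidiag n D i j.
Proof. by move=> D0; rewrite mxE addr_ge0 ?ler0n ?mulrn_wge0. Qed.

Lemma bidiag_norm (n : nat) (D : int) : 0 < D -> mx_norm (bidiag n.+2 D) = D.
Proof.
move=> D0; apply/le_anti/andP; split.
  rewrite mx_normrE; apply: bigmax_le => [|[i j] _ /=]; first exact: ltW.
  rewrite mxE -val_eqE /=; have [->|_] := eqVneq (i : nat) (j : nat).
    by rewrite ltn_eqF// addr0; lia.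
  by rewrite add0r; case: (_ == _); rewrite ?normr0 ?gtr0_norm// ltW.
(* The size is at least 2, so the subdiagonal entry at (1, 0) exists and attains [D]. *)
apply: le_trans (le_mx_norm _ (@Ordinal n.+2 1 isT) ord0).
by rewrite mxE /= add0r gtr0_norm.
Qed.

Theorem theorem1 (R : realType) :
  exists2 gamma : R, 0 < gamma &
  forall (Delta : int) (d : nat), 0 < Delta -> (0 < d)%N -> ~~ odd d ->
  exists (A : 'M[int]_(d, d)) (b b' : 'cV[int]_d),
    (full_row_rank A /\
     (forall i j, 0 <= A i j) /\
     mx_norm A = Delta /\
     (forall i, 0 <= b i 0) /\
     (forall i, 0 <= b' i 0) /\
     norm1 (b - b') = 1 /\
     IntSol A b 0 !=set0 /\
     IntSol A b' 0 !=set0 /\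
     (((Delta%:~R : R) `^ (gamma * d%:R))%:E <= sens R A b b' 0)%E /\
     polytopish R A).
Proof.
exists 2^-1; first by rewrite invr_gt0.
(* Positivity excludes [d = 0] and evenness excludes [d = 1], leaving [d = n.+2]. *)
move=> D [//|[//|n]] D0 _ _.
set A := bidiag n.+2 D; set z := alt_powers n.+2 D.
have Au : A \in unitmx := bidiag_unitmx _ _.
pose x : 'cV[int]_n.+2 := \col_i Num.max (z i 0) 0.
pose y : 'cV[int]_n.+2 := \col_i Num.max (- z i 0) 0.
have x0 i : 0 <= x i 0 by rewrite mxE le_max lexx orbT.
have y0 i : 0 <= y i 0 by rewrite mxE le_max lexx orbT.
have xy : x - y = z by apply/colP => i; rewrite !mxE; lia.
have A0 i j : 0 <= A i j by apply: bidiag_ge0; apply: ltW.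
have b0 (u : 'cV_n.+2) : (forall i, 0 <= u i 0) -> forall i, 0 <= (A *m u) i 0.
  by move=> u0 i; rewrite mxE sumr_ge0// => j _; apply: mulr_ge0.
exists A, (A *m x), (A *m y); do ![split] => //; try exact: b0.
- exact: unitmx_full_row_rank.
- exact: bidiag_norm.
- rewrite -mulmxBr xy bidiag_alt_powers /norm1 (bigD1 ord0)//= mxE eqxx.
  by rewrite big1 // => i /negPf i0; rewrite mxE i0.
- by exists x; rewrite IntSol_unitmx.
- by exists y; rewrite IntSol_unitmx.
- rewrite sens_unitmx// xy lee_fin.
  (* The last entry of [z] has absolute value [D ^+ n.+1]. As [D] is at least 1, it remains to
     compare exponents: (n + 2) / 2 is at most n + 1. *)
  apply: le_trans (le_mx_norm _ ord_max ord0).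
  rewrite !mxE /= rmorphXn normrX rmorphN normrN gtr0_norm ?ltr0z//.
  rewrite -powR_mulrn ?ler0z ?(ltW D0)//=; apply: ler_powR.
    by rewrite -[1]/(1%:~R) ler_int.
  by rewrite mulrC ler_pdivrMr// -natrM ler_nat; lia.
- exact: unitmx_polytopish.
Qed.
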